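(* Given a probability distribution $P = p_1, \ldots, p_n$ and $\epsilon > 0$, we can construct a data structure that uses $2n + o(n)$ bits of space and supports a query that, given $i$ between $1$ and $n$, returns $q_i$ in $O(\log(1/q_i))$ time. Here, $Q = q_1, \ldots, q_n$ is a probability distribution with $D(P \| Q) < 2 + \epsilon$ and $\log(1/q_i) \in O(\log \min(1/p_i, n/\epsilon))$.
   Context: A probability distribution $P = p_1, \ldots, p_n$ is simply a (finite, ordered) sequence of non-negative real numbers that sum to $1$; the sample space is not stored. $\log$ means $\log_2$. The relative entropy of $P$ with respect to $Q$ is $D(P \| Q) = \sum_{i=1}^n p_i \log \frac{p_i}{q_i}$ (terms with $p_i = 0$ contribute $0$). The distribution $Q$ depends on $P$ and $\epsilon$ only (not on the query), and the query is answered from the stored data structure without decompressing it. Time is the number of elementary steps of the query algorithm.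
   Formalization: The bound on log(1/q_i) is read as a constant times max(1, log min(1/p_i, n/ε)), where the constant may grow with ε but is uniform for all ε up to any fixed value; the query time is likewise O(max(1, log(1/q_i))). *)

(* Defs.v *)
From HB Require Import structures.
From mathcomp Require Import all_boot all_order all_algebra.
From mathcomp Require Import all_classical all_reals all_analysis.

Set Implicit Arguments.
Unset Strict Implicit.
Unset Printing Implicit Defensive.

Import Order.TTheory GRing.Theory Num.Theory.
Import numFieldNormedType.Exports.

Local Open Scope ring_scope.

Section Distributions.
Variables (R : realType) (n : nat).

Definition log2 (x : R) : R := ln x / ln 2.

Definition is_distribution (p : 'I_n -> R) : Prop :=
  (forall i, 0 <= p i) /\ \sum_(i < n) p i = 1.

(* Extended-real valued, so that D(P || Q) = +oo as soon as some q_i = 0 < p_i;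
   no summand is -oo. *)
Definition relative_entropy (p q : 'I_n -> R) : \bar R :=
  (\sum_(i < n) (if p i == 0%R then 0
                 else if q i == 0%R then +oo
                 else (p i * log2 (p i / q i))%:E))%E.

(* min(1/p, b) with the convention 1/0 = +oo (in MathComp 0^-1 = 0). *)
Definition min_inv (p b : R) : R :=
  if p == 0 then b else Num.min p^-1 b.

End Distributions.

(* Word RAM.  The data structure is a read-only bit string [D], packed into
   words of [w] bits and accessed one word at a time; the working storage is a
   register file, of which a program touches only finitely many registers, each
   holding one [w]-bit word.  Every instruction costs one step. *)

Inductive word_op : Type :=
  | OpAdd | OpSub | OpMul | OpDiv | OpMod
  | OpAnd | OpOr | OpXor | OpShl | OpShr
  | OpLt | OpEq.

Inductive instr : Type :=
  | Const of nat & nat                   (* r := k *)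
  | Op of word_op & nat & nat & nat      (* r := a op b *)
  | Read of nat & nat                    (* r := word of D number a *)
  | Jump of nat
  | JumpZ of nat & nat.                  (* jump to l if r holds 0 *)

Definition program : Type := seq instr.

Record state : Type := State { pc : nat; reg : nat -> nat }.

Section Machine.
Local Open Scope nat_scope.
Variables (w : nat) (D : seq bool).

(* Little-endian; the bit string is padded with zeros. *)
Definition data_word (a : nat) : nat :=
  \sum_(k < w) nth false D (a * w + k) * 2 ^ k.

Definition eval_op (o : word_op) (a b : nat) : nat :=
  (match o with
   | OpAdd => a + b
   | OpSub => a + (2 ^ w - b)
   | OpMul => a * b
   | OpDiv => a %/ b
   | OpMod => a %% b
   | OpAnd => Nat.land a b
   | OpOr => Nat.lor a b
   | OpXor => Nat.lxor a b
   | OpShl => a * 2 ^ b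
   | OpShr => a %/ 2 ^ b
   | OpLt => a < b
   | OpEq => a == b
   end) %% 2 ^ w.

Definition set_reg (s : state) (r v : nat) : state :=
  State (pc s).+1 [eta reg s with r |-> v].

Definition exec_instr (s : state) (c : instr) : state :=
  match c with
  | Const r k => set_reg s r (k %% 2 ^ w)
  | Op o r a b => set_reg s r (eval_op o (reg s a) (reg s b))
  | Read r a => set_reg s r (data_word (reg s a))
  | Jump l => State l (reg s)
  | JumpZ r l => State (if reg s r == 0 then l else (pc s).+1) (reg s)
  end.

(* A program halts when the program counter leaves it. *)
Definition halted (prog : program) (s : state) : bool := size prog <= pc s.

Definition step (prog : program) (s : state) : state :=
  if halted prog s then s else exec_instr s (nth (Jump 0) prog (pc s)).

Definition init_state (x : nat) : state :=
  State 0 (fun r => if r == 0 then x else 0).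

End Machine.

(* The argument [x] is passed in register 0; the answer is the rational number
   (num / den) * 2^-e, where num, den and e are the words that registers 0, 1
   and 2 hold on termination. *)
Definition query_returns (R : realType) (prog : program) (w : nat)
    (D : seq bool) (x t : nat) (q : R) : Prop :=
  let s := iter t (step w D prog) (init_state x) in
  halted prog s /\
  q = (reg s 0)%:R / (reg s 1)%:R * 2 ^- (reg s 2).

(* Words of Theta(log n) bits; for 0 < c, n < 2 ^ (word_size c n). *)
Definition word_size (c n : nat) : nat := (c * (trunc_log 2 n).+1)%N.

(* Main.v *)
(** Idea. Let l_i = floor(n p_i / 3) + 1 and N = l_1 + ... + l_n <= 4n/3, and
    take q_i = l_i / N. Then p_i < 4 q_i, so D(P || Q) < 2 whatever eps is, and
    1/q_i <= N. Store a bit vector of length about N in which element i occupies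
    a run of l_i consecutive positions, marking the starts of the runs. It is cut
    into blocks of four words, and for each block a directory of two words gives
    the run through its first position: N * (1 + 2/4) <= 2n bits in all.
    To answer a query, search the directory by bisection. If the run of i
    contains a block boundary, it contains a fraction of about q_i of all the
    boundaries, so bisection meets one after log (1/q_i) + O(1) steps. Otherwise
    the run lies inside one block of O(log n) bits, which is scanned bit by bit;
    in this case l_i = O(log n), hence log (1/q_i) is at least of order log n. *)

Require Import Defs.
From HB Require Import structures.
From mathcomp Require Import all_boot all_order all_algebra.
From mathcomp Require Import all_classical all_reals all_analysis.
From mathcomp Require Import zify lra.

Set Implicit Arguments.
Unset Strict Implicit.
Unset Printing Implicit Defensive.

Import Order.TTheory GRing.Theory Num.Theory.
Import numFieldNormedType.Exports.

Local Open Scope classical_set_scope.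
Local Open Scope ring_scope.

(** * Words and runs *)

Section BinaryWords.
Local Open Scope nat_scope.

Lemma bits_ltn (b : nat -> bool) (w : nat) :
  \sum_(k < w) b k * 2 ^ k < 2 ^ w.
Proof.
elim: w => [|w IH]; first by rewrite big_ord0.
rewrite big_ord_recr /= expnS mul2n -addnn -addSn leq_add //.
by case: (b w); rewrite ?mul1n.
Qed.

Lemma nth_bit (b : nat -> bool) (w j : nat) : j < w ->
  (\sum_(k < w) b k * 2 ^ k) %/ 2 ^ j %% 2 = b j.
Proof.
move=> lt_jw; rewrite -(subnKC (ltnW lt_jw)) big_split_ord /=.
under [X in _ + X]eq_bigr => i _ do rewrite expnD mulnCA.
rewrite -big_distrr /= addnC mulnC divnMDl ?expn_gt0 // (divn_small (bits_ltn b j)).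
rewrite addn0; have -> : w - j = (w - j).-1.+1 by lia.
rewrite big_ord_recl /= addn0 muln1.
under eq_bigr => i _ do rewrite expnS mulnCA.
by rewrite -big_distrr /= addnC mulnC modnMDl; case: (b j).
Qed.

Lemma bits_of_nat (v w : nat) : v < 2 ^ w ->
  \sum_(k < w) odd (v %/ 2 ^ k) * 2 ^ k = v.
Proof.
elim: w v => [|w IH] v lt_v.
  by rewrite big_ord0; move: lt_v; rewrite expn0; case: v.
rewrite big_ord_recl /= divn1 muln1.
under eq_bigr => i _ do rewrite /bump /= add1n expnS divnMA divn2 mulnCA.
rewrite -big_distrr /= IH; first by rewrite mul2n odd_double_half.
by move: lt_v; rewrite expnS; lia.
Qed.

End BinaryWords.

Section Runs.
Local Open Scope nat_scope.
Variables (n : nat) (len : nat -> nat).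
Hypothesis len_gt0 : forall i, 0 < len i.

(* Run number k < n starts here; position 0 is kept free as a sentinel. *)
Definition run_start (k : nat) : nat := (\sum_(i < k) len i).+1.

(* The 1-based number of the run through [pos]: 0 at the sentinel, n + 1 past
   the last run. *)
Definition run_at (pos : nat) : nat :=
  find (fun k => pos < run_start k) (iota 0 n.+1).

Lemma run_startS (k : nat) : run_start k.+1 = run_start k + len k.
Proof. by rewrite /run_start big_ord_recr addSn. Qed.

Lemma leq_run_start : {homo run_start : i j / i <= j}.
Proof. 
by apply: homo_leq => [//|j i k /leq_trans|i]; [exact | rewrite run_startS leq_addr].
Qed.

Lemma run_at_max (pos : nat) : run_at pos <= n.+1.
Proof. by rewrite -[X in _ <= X](size_iota 0) find_size. Qed.

(** [run_at] and [run_start] are adjoint: since the starts are monotone, the first start beyond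
    [pos] decides all comparisons. *)
Lemma leq_run_at (pos i : nat) : i <= n -> (run_at pos <= i) = (pos < run_start i).
Proof.
move=> le_in; apply/idP/idP => [le_i|lt_pos].
  have has_pos : has (fun k => pos < run_start k) (iota 0 n.+1).
    by rewrite has_find size_iota ltnS (leq_trans le_i).
  apply: leq_trans (leq_run_start le_i); have := nth_find 0 has_pos.
  by rewrite nth_iota ?add0n // ltnS (leq_trans le_i).
rewrite leqNgt; apply/negP => /(before_find 0).
by rewrite nth_iota // add0n lt_pos.
Qed.

(** Runs are nonempty, so one step to the right crosses at most one start. This is why one bit per
    position is enough to track the run number. *)
Lemma run_atS (pos : nat) :
  run_at pos.+1 = run_at pos + (run_at pos < run_at pos.+1).
Proof.
have mono : run_at pos <= run_at pos.+1.
  have := run_at_max pos.+1; case: (leqP (run_at pos.+1) n) => [le_n _|? ?].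
    by rewrite leq_run_at // ltnW // -leq_run_at.
  by rewrite (leq_trans (run_at_max _)).
suff : run_at pos.+1 <= (run_at pos).+1 by lia.
case: (leqP (run_at pos) n.-1) => [le_n|]; last by have := run_at_max pos.+1; lia.
have [n0|n_gt0] := posnP n; first by have := run_at_max pos.+1; lia.
rewrite leq_run_at; last by lia.
have : pos < run_start (run_at pos) by rewrite -leq_run_at //; lia.
by rewrite run_startS; have := len_gt0 (run_at pos); lia.
Qed.

End Runs.

(** * The query program *)

Lemma data_word_ltn (w : nat) (D : seq bool) (r : nat) :
  (data_word w D r < 2 ^ w)%N.
Proof. exact: (bits_ltn (fun k => nth false D (r * w + k))). Qed.

(* Registers: 0 = queried run number, 1 = N, 4 and 5 = the interval of blocks,
   6 = middle block, then scanned position, 8 = number of the run there,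
   10 = word size, 11 = address of the bit vector, 12 = length of the run so far;
   registers 2, 3 and 9 hold 0, 1 and 2. Numbers in comments are jump targets. *)
Definition query_program : program :=
  [:: Read 1 2; Const 3 1; Read 5 3; Const 9 3; Read 11 9; Const 9 2; Read 10 9;
      (* 7: bisection *)
      Op OpAdd 6 4 3; Op OpLt 6 6 5; JumpZ 6 26;
      Op OpAdd 6 4 5; Op OpShr 6 6 3; Op OpAdd 7 6 9; Op OpShl 7 7 3; Read 8 7;
      Op OpEq 12 8 0; JumpZ 12 20; Op OpAdd 7 7 3; Read 0 7; Jump 45;
      (* 20 *)
      Op OpLt 12 8 0; JumpZ 12 24; Op OpAdd 4 6 2; Jump 7;
      (* 24 *)
      Op OpAdd 5 6 2; Jump 7;
      (* 26: start of the scan *)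
      Op OpAdd 7 4 9; Op OpShl 7 7 3; Read 8 7; Op OpMul 6 4 10; Op OpShl 6 6 9;
      Const 12 0;
      (* 32: scan loop *)
      Op OpAdd 6 6 3; Op OpDiv 7 6 10; Op OpAdd 7 7 11; Read 7 7; Op OpMod 13 6 10;
      Op OpShr 7 7 13; Op OpMod 7 7 9; Op OpAdd 8 8 7; Op OpEq 7 8 0;
      Op OpAdd 12 12 7; Op OpLt 7 0 8; JumpZ 7 32; Op OpAdd 0 12 2].

(** * Correctness and step count of the query, for an abstract rank function and a queried run
    [[a, a + l)] *)

Section QueryCorrectness.
Local Open Scope nat_scope.
Variables (w : nat) (D : seq bool) (x N M base : nat).
Variables (rank : nat -> nat) (a l : nat).

Local Notation block := (4 * w).

Hypothesis word_N : data_word w D 0 = N.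
Hypothesis word_M : data_word w D 1 = M.
Hypothesis word_w : data_word w D 2 = w.
Hypothesis word_base : data_word w D 3 = base.
Hypothesis directory_rank :
  forall j, j < M -> data_word w D (4 + 2 * j) = rank (block * j).
Hypothesis directory_length :
  forall j, j < M -> rank (block * j) = x -> data_word w D (5 + 2 * j) = l.
Hypothesis bitvector : forall pos, pos < a + l ->
  data_word w D (base + pos.+1 %/ w) %/ 2 ^ (pos.+1 %% w) %% 2
  = (rank pos < rank pos.+1).
Hypothesis rankS :
  forall pos, rank pos.+1 = rank pos + (rank pos < rank pos.+1).
Hypothesis rank_lt : forall pos, (rank pos < x) = (pos < a).
Hypothesis rank_gt : forall pos, (x < rank pos) = (a + l <= pos).
Hypotheses (w_gt0 : 0 < w) (a_gt0 : 0 < a) (M_gt0 : 0 < M).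
Hypothesis run_fits : a + l <= block * M.
Hypothesis x_small : x.+1 < 2 ^ w.
Hypothesis addr_small : base + block * M + 2 * M + 8 < 2 ^ w.

Let returned (s : state) : bool :=
  [&& halted query_program s, reg s 0 == l, reg s 1 == N & reg s 2 == 0].

(** An upper bound on the steps, not an exact count, so that branches of different lengths can share
    one bound. *)
Let returns_within (t : nat) (s : state) : Prop :=
  exists2 t', t' <= t & returned (iter t' (step w D query_program) s).

(** Registers as a finite list padded with zeros, so that symbolic execution reduces to computation
    on lists. *)
Let at_ (i : nat) (regs : seq nat) : state := State i (nth 0 regs).

Lemma returns_within_leq t t' s :
  returns_within t s -> t <= t' -> returns_within t' s.
Proof. by move=> [u le_ut ret] le_tt'; exists u => //; exact: leq_trans le_tt'. Qed.

Lemma returns_within_step t s : returns_within t (step w D query_program s) ->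
  returns_within t.+1 s.
Proof. by move=> [u le_ut ret]; exists u.+1 => //; rewrite iterSr. Qed.

Lemma set_reg_at i regs r v :
  set_reg (at_ i regs) r v = at_ i.+1 (set_nth 0 regs r v).
Proof.
rewrite /set_reg /at_ /=; congr State; apply: funext => k.
by rewrite nth_set_nth.
Qed.

Lemma step_at i regs c : i < size query_program ->
  nth (Jump 0) query_program i = c ->
  step w D query_program (at_ i regs) = exec_instr w D (at_ i regs) c.
Proof. by move=> lt_i <-; rewrite /step /halted leqNgt lt_i. Qed.

(** This rule and its analogues for the other instructions are applied backwards to execute the
    program symbolically. *)
Lemma run_op t i regs o r r1 r2 v : i < size query_program ->
  nth (Jump 0) query_program i = Op o r r1 r2 ->
  eval_op w o (nth 0 regs r1) (nth 0 regs r2) = v ->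
  returns_within t (at_ i.+1 (set_nth 0 regs r v)) ->
  returns_within t.+1 (at_ i regs).
Proof.
move=> lt_i instr_i <- ret; apply: returns_within_step.
by rewrite (step_at _ lt_i instr_i) /= set_reg_at.
Qed.

Lemma run_const t i regs r k : i < size query_program ->
  nth (Jump 0) query_program i = Const r k -> k < 2 ^ w ->
  returns_within t (at_ i.+1 (set_nth 0 regs r k)) ->
  returns_within t.+1 (at_ i regs).
Proof.
move=> lt_i instr_i lt_k ret; apply: returns_within_step.
by rewrite (step_at _ lt_i instr_i) /= set_reg_at modn_small.
Qed.

Lemma run_read t i regs r r1 v : i < size query_program ->
  nth (Jump 0) query_program i = Read r r1 ->
  data_word w D (nth 0 regs r1) = v ->
  returns_within t (at_ i.+1 (set_nth 0 regs r v)) ->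
  returns_within t.+1 (at_ i regs).
Proof.
move=> lt_i instr_i <- ret; apply: returns_within_step.
by rewrite (step_at _ lt_i instr_i) /= set_reg_at.
Qed.

Lemma run_jump t i regs j : i < size query_program ->
  nth (Jump 0) query_program i = Jump j ->
  returns_within t (at_ j regs) -> returns_within t.+1 (at_ i regs).
Proof.
move=> lt_i instr_i ret; apply: returns_within_step.
by rewrite (step_at _ lt_i instr_i).
Qed.

Lemma run_jumpz t i regs r j : i < size query_program ->
  nth (Jump 0) query_program i = JumpZ r j ->
  returns_within t (at_ (if nth 0 regs r == 0 then j else i.+1) regs) ->
  returns_within t.+1 (at_ i regs).
Proof.
move=> lt_i instr_i ret; apply: returns_within_step.
by rewrite (step_at _ lt_i instr_i).
Qed.

Lemma run_halt t i regs : size query_program <= i ->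
  nth 0 regs 0 = l -> nth 0 regs 1 = N -> nth 0 regs 2 = 0 ->
  returns_within t (at_ i regs).
Proof.
move=> le_i r0 r1 r2; exists 0 => //.
by rewrite /returned /= /halted le_i r0 r1 r2 !eqxx.
Qed.

Lemma rank_eq pos : (rank pos == x) = (a <= pos < a + l).
Proof.
rewrite [LHS]eqn_leq [X in X && _]leqNgt [X in _ && X]leqNgt rank_gt rank_lt.
by rewrite -ltnNge -leqNgt andbC.
Qed.

Let bit_ltn (b : bool) : b < 2 ^ w.
Proof. by apply: leq_ltn_trans (leq_b1 b) _; lia. Qed.

(** Loop invariant: register 8 holds the rank of [pos] and register 12 the part of the run seen so
    far, a truncated difference that is 0 before the run. A pass takes 12 instructions and the exit
    one more. *)
Lemma scan_returns k pos r7 r13 lo hi : pos + k = a + l -> pos < a + l ->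
  returns_within (12 * k + 1)
    (at_ 32 [:: x; N; 0; 1; lo; hi; pos; r7; rank pos; 2; w; base; pos.+1 - a; r13]).
Proof.
elim: k pos r7 r13 => [|k IH] pos r7 r13 def_k lt_pos; first by lia.
have le_pos : rank pos <= x by rewrite leqNgt rank_gt -ltnNge.
have le_pos1 : rank pos.+1 <= x.+1.
  by rewrite rankS -[x.+1]addn1 leq_add // leq_b1.
have div_pos : pos.+1 %/ w <= pos.+1 := leq_div _ _.
have small_pos : base + pos.+1 < 2 ^ w by lia.
apply: (@returns_within_leq (12 * k + 1).+4.+4.+4); last by lia.
apply: (run_op (v := pos.+1)) => //=; first by rewrite /eval_op modn_small; lia.
apply: (run_op (v := pos.+1 %/ w)) => //=; first by rewrite /eval_op modn_small; lia.
apply: (run_op (v := base + pos.+1 %/ w)) => //=; first by rewrite /eval_op modn_small; lia.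
apply: run_read => //=.
apply: (run_op (v := pos.+1 %% w)) => //=.
  by rewrite /eval_op modn_small // (leq_ltn_trans (leq_mod _ _)) //; lia.
apply: (run_op (v := data_word w D (base + pos.+1 %/ w) %/ 2 ^ (pos.+1 %% w))) => //=.
  rewrite /eval_op modn_small //; apply: leq_ltn_trans (leq_div _ _) _.
  exact: data_word_ltn.
apply: (run_op (v := rank pos < rank pos.+1)) => //=.
  by rewrite /eval_op bitvector // modn_small.
apply: (run_op (v := rank pos.+1)) => //=.
  by rewrite /eval_op -rankS modn_small //; lia.
apply: (run_op (v := rank pos.+1 == x)) => //=; first by rewrite /eval_op /= modn_small.
(* The minimum accounts for the last pass, where [pos.+1 = a + l] is outside the run and the count
   stays at [l]. *)
apply: (run_op (v := minn (pos.+2 - a) l)) => //=.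
  have le_l : l < 2 ^ w. by move: addr_small run_fits; lia.
  rewrite /eval_op rank_eq.
  case: (boolP (a <= pos.+1 < a + l)) => in_run; rewrite (addn0, addn1).
    by rewrite modn_small; lia.
  by rewrite modn_small; lia.
apply: (run_op (v := x < rank pos.+1)) => //=; first by rewrite /eval_op /= modn_small.
apply: run_jumpz => //=.
rewrite rank_gt; case: (leqP (a + l) pos.+1) => ? /=.
  rewrite addn1; apply: run_op => //=; apply: run_halt => //=.
  by rewrite /eval_op addn0 modn_small; lia.
by rewrite (minn_idPl _); [apply: IH; lia | lia].
Qed.

(** Bisection invariant: boundary [lo] precedes the run and boundary [hi] follows it, so every
    boundary in the run lies strictly between them. *)
Let valid (lo hi : nat) : bool :=
  [&& lo < hi, hi <= M, block * lo < a & a + l <= block * hi].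

Let directory_small j : j < M -> 2 * j + 5 < 2 ^ w.
Proof. by move: addr_small; lia. Qed.

Lemma scan_block_returns lo r6 r7 r8 r12 r13 : valid lo lo.+1 ->
  returns_within (12 * block + 7)
    (at_ 26 [:: x; N; 0; 1; lo; lo.+1; r6; r7; r8; 2; w; base; r12; r13]).
Proof.
case/and4P=> _ lt_loM lo_a hi_al; have small_lo := directory_small lt_loM.
have small_pos : block * lo < 2 ^ w by move: addr_small run_fits; lia.
have small_wlo : lo * w < 2 ^ w by lia.
set k := a + l - block * lo.
have le_k : k <= block by rewrite /k; move: hi_al; rewrite mulnS; lia.
apply: (@returns_within_leq (12 * k + 1).+4.+2); last by lia.
apply: (run_op (v := lo + 2)) => //=; first by rewrite /eval_op modn_small; lia.
apply: (run_op (v := 4 + 2 * lo)) => //=.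
  by rewrite /eval_op expn1 modn_small; lia.
apply: run_read => //=; rewrite directory_rank //.
apply: (run_op (v := lo * w)) => //=; first by rewrite /eval_op modn_small.
apply: (run_op (v := block * lo)) => //=.
  rewrite /eval_op (_ : lo * w * 2 ^ 2 = block * lo) ?modn_small //.
  by rewrite [LHS]mulnC [lo * w]mulnC mulnA.
apply: run_const => //=; first by lia.
(* As [block * lo < a], the truncated difference in the scan invariant is 0, the value just loaded
   into register 12. *)
by have := @scan_returns k (block * lo) (4 + 2 * lo) r13 lo lo.+1;
   rewrite (_ : _ - a = 0); [apply; rewrite /k; lia | lia].
Qed.

(** One round of bisection, whose longest path has 14 instructions. Scan and next round are passed
    as hypotheses, so that a single symbolic execution serves both cases of the induction on the
    depth. *)
Lemma search_step t lo hi r6 r7 r8 r12 r13 : valid lo hi ->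
  (hi = lo.+1 -> forall r6 r7 r8 r12 r13, returns_within t
    (at_ 26 [:: x; N; 0; 1; lo; lo.+1; r6; r7; r8; 2; w; base; r12; r13])) ->
  (forall lo' hi' r6 r7 r8 r12 r13, 1 < hi - lo -> valid lo' hi' ->
    2 * (hi' - lo') <= (hi - lo).+1 -> returns_within t
    (at_ 7 [:: x; N; 0; 1; lo'; hi'; r6; r7; r8; 2; w; base; r12; r13])) ->
  returns_within (14 + t)
    (at_ 7 [:: x; N; 0; 1; lo; hi; r6; r7; r8; 2; w; base; r12; r13]).
Proof.
move=> val_lohi; case/and4P: (val_lohi) => lt_lohi le_hiM lo_a hi_al scan loop.
have small_M : 2 * M + 5 < 2 ^ w by move: addr_small; lia.
rewrite addnC 14!addnS addn0.
apply: (run_op (v := lo.+1)) => //=; first by rewrite /eval_op modn_small; lia.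
apply: (run_op (v := lo.+1 < hi)) => //=; first by rewrite /eval_op modn_small.
apply: run_jumpz => //=.
case: (ltnP lo.+1 hi) => [gt1|le1] /=; last first.
  have def_hi : hi = lo.+1 by lia.
  by apply: returns_within_leq (leq_addl 11 t); rewrite def_hi; apply: scan.
set mid := (lo + hi) %/ 2.
have /andP[lo_mid mid_hi] : lo < mid < hi by rewrite /mid; lia.
have lt_midM : mid < M := leq_trans mid_hi le_hiM.
apply: (run_op (v := lo + hi)) => //=; first by rewrite /eval_op modn_small; lia.
apply: (run_op (v := mid)) => //=; first by rewrite /eval_op expn1 modn_small; lia.
apply: (run_op (v := mid + 2)) => //=; first by rewrite /eval_op modn_small; lia.
apply: (run_op (v := 4 + 2 * mid)) => //=.
  by rewrite /eval_op expn1 modn_small; lia.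
apply: run_read => //=; rewrite directory_rank //.
apply: (run_op (v := rank (block * mid) == x)) => //=.
  by rewrite /eval_op modn_small.
apply: run_jumpz => //=.
case: (eqVneq (rank (block * mid)) x) => [eq_x|neq_x] /=.
  apply: (run_op (v := 5 + 2 * mid)) => //=.
    by rewrite /eval_op modn_small; lia.
  apply: run_read => //=; rewrite directory_length //.
  by apply: run_jump => //=; apply: run_halt.
apply: (run_op (v := rank (block * mid) < x)) => //=.
  by rewrite /eval_op modn_small.
apply: run_jumpz => //=; rewrite rank_lt.
case: ltnP => [lt_a|ge_a] /=.
  apply: (run_op (v := mid)) => //=; first by rewrite /eval_op modn_small; lia.
  apply: run_jump => //=; apply: loop; [lia | | rewrite /mid; lia].
  by rewrite /valid mid_hi le_hiM lt_a.
apply: (run_op (v := mid)) => //=; first by rewrite /eval_op modn_small; lia.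
apply: run_jump => //=; apply: loop; [lia | | rewrite /mid; lia].
rewrite /valid lo_mid (ltnW lt_midM) lo_a /= -rank_gt.
by rewrite ltn_neqAle eq_sym neq_x leqNgt rank_lt -leqNgt.
Qed.

(* This is what makes long runs fast to find: bisection cannot shrink a valid
   interval below the length of the run. *)
Lemma valid_width lo hi : valid lo hi -> l %/ block < hi - lo.
Proof.
case/and4P=> _ _ lo_a hi_al; rewrite ltn_divLR; last by lia.
by rewrite mulnC mulnBr; lia.
Qed.

(** Only a run that fits between two consecutive boundaries is scanned, and such a run is shorter
    than a block. *)
Let scan_time := if l < block then 12 * block + 7 else 0.

(** Each round halves the width up to rounding, which the even bound [(l %/ block).+1 * 2 ^ d.+1]
    absorbs. *)
Lemma search_returns d lo hi r6 r7 r8 r12 r13 : valid lo hi ->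
  hi - lo <= (l %/ block).+1 * 2 ^ d ->
  returns_within (14 * d.+1 + scan_time)
    (at_ 7 [:: x; N; 0; 1; lo; hi; r6; r7; r8; 2; w; base; r12; r13]).
Proof.
elim: d lo hi r6 r7 r8 r12 r13 => [|d IH] lo hi r6 r7 r8 r12 r13 val_lohi le_hi;
  rewrite mulnS -addnA; apply: search_step => // [def_hi|].
- move=> *; apply: returns_within_leq (scan_block_returns _ _ _ _ _ _) _.
    by rewrite -def_hi.
  have := valid_width val_lohi; rewrite def_hi subSnn ltnS leqn0 -leqn0.
  rewrite leqNgt divn_gt0 -?ltnNge; last by lia.
  by rewrite /scan_time => ->; lia.
(* At [d = 0] the width is at most the minimal one of a valid interval, so no further halving is
   possible. *)
- move=> lo' hi' ? ? ? ? ? gt1 /valid_width wide halved.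
  by move: le_hi; rewrite muln1; lia.
- move=> *; apply: returns_within_leq (scan_block_returns _ _ _ _ _ _) _.
    by rewrite -def_hi.
  have := valid_width val_lohi; rewrite def_hi subSnn ltnS leqn0 -leqn0.
  rewrite leqNgt divn_gt0 -?ltnNge; last by lia.
  by rewrite /scan_time => ->; lia.
- move=> lo' hi' ? ? ? ? ? gt1 val' halved; apply: IH => //.
  by move: le_hi; rewrite expnS mulnCA; lia.
Qed.

Lemma query_returns_run (R : realType) d :
  M <= (l %/ block).+1 * 2 ^ d ->
  exists2 t, t <= 14 * d + scan_time + 21 &
    query_returns query_program w D x t (l%:R / N%:R : R)%R.
Proof.
move=> le_M.
suff [t le_t /and4P[halt /eqP r0 /eqP r1 /eqP r2]] :
    returns_within (14 * d + scan_time + 21) (at_ 0 (x :: nseq 13 0)).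
  have init_eq : init_state x = at_ 0 (x :: nseq 13 0).
    congr State; apply: funext => -[|k] //=.
    by rewrite -[0 :: _]/(nseq 13 0) nth_nseq if_same.
  exists t => //; rewrite /query_returns init_eq r0 r1 r2.
  by split=> //; rewrite expr0 invr1 mulr1.
(* Seven instructions load the header and the constants. *)
apply: (@returns_within_leq (14 * d.+1 + scan_time).+4.+3); last by lia.
have small3 : 3 < 2 ^ w by lia.
apply: run_read => //=; rewrite word_N.
apply: run_const => //=; first by lia.
apply: run_read => //=; rewrite word_M.
apply: run_const => //=.
apply: run_read => //=; rewrite word_base.
apply: run_const => //=; first by lia.
apply: run_read => //=; rewrite word_w.
apply: search_returns; last by rewrite subn0.
(* Boundary 0 is the sentinel position, which precedes every run. *)
by rewrite /valid M_gt0 leqnn muln0 a_gt0.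
Qed.

End QueryCorrectness.

(** * The data structure *)

Section DataStructure.
Local Open Scope nat_scope.
Variables (n w : nat) (len : nat -> nat).
Hypotheses (len_gt0 : forall i, 0 < len i) (w_gt0 : 0 < w).

Definition total_length : nat := \sum_(i < n) len i.
(** Rounded so that the final boundary lies beyond the end of the last run. *)
Definition nb_blocks : nat := (total_length.+1 %/ (4 * w)).+1.
Definition bitvector_base : nat := 4 + 2 * nb_blocks.

(* Runs are numbered from 1 by [run_at], whence [len k.-1]; the
   lengths recorded for the sentinel and past the last run are junk. *)
Definition directory_word (r : nat) : nat :=
  if r == 0 then total_length
  else if r == 1 then nb_blocks
  else if r == 2 then w
  else if r == 3 then bitvector_base
  else let k := run_at n len (4 * w * ((r - 4) %/ 2)) in
       if odd r then len k.-1 else k.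

(** After the directory, a bit is set at each run start and also just past the last run, which stops
    the scan of run [n]. At position 0 the truncated predecessor makes the bit 0. *)
Definition structure_bit (b : nat) : bool :=
  if b < bitvector_base * w then odd (directory_word (b %/ w) %/ 2 ^ (b %% w))
  else let pos := b - bitvector_base * w in
       run_at n len pos.-1 < run_at n len pos.

Definition structure_bits : seq bool :=
  mkseq structure_bit (bitvector_base * w + total_length.+2).

(** The directory spends [2 * w] bits per [4 * w] positions, half a bit each, so the main term is
    3/2 of the total length. The rest is four header words, two words for rounding up the number of
    blocks, and a few bits. *)
Lemma size_structure_bits : 3 * total_length <= 4 * n ->
  size structure_bits <= 2 * n + (6 * w + 3).
Proof.
move=> le_N; rewrite size_mkseq /bitvector_base /nb_blocks mulnDl -mulnA mulSn.
have : total_length.+1 %/ (4 * w) * (4 * w) <= total_length.+1 by exact: leq_divM.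
rewrite mulnCA; lia.
Qed.

Lemma directory_wordE r : r < bitvector_base -> directory_word r < 2 ^ w ->
  data_word w structure_bits r = directory_word r.
Proof.
move=> lt_r small_r; rewrite -[RHS](bits_of_nat small_r).
apply: eq_bigr => k _; have lt_b : r * w + k < bitvector_base * w.
  by apply: leq_trans (leq_mul lt_r (leqnn w)); rewrite mulSn addnC ltn_add2r.
rewrite nth_mkseq ?(leq_trans lt_b) ?leq_addr // /structure_bit lt_b.
by rewrite divnMDl // modnMDl (divn_small (ltn_ord k)) (modn_small (ltn_ord k)) addn0.
Qed.

Lemma bitvectorE pos : pos <= total_length ->
  data_word w structure_bits (bitvector_base + pos.+1 %/ w)
    %/ 2 ^ (pos.+1 %% w) %% 2
  = (run_at n len pos < run_at n len pos.+1).
Proof.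
move=> le_pos; set r := bitvector_base + _.
rewrite (nth_bit (fun k => nth false structure_bits (r * w + k))) ?ltn_mod //.
have -> : r * w + pos.+1 %% w = bitvector_base * w + pos.+1.
  by rewrite /r mulnDl -addnA -divn_eq.
rewrite nth_mkseq ?ltn_add2l ?ltnS //.
by rewrite /structure_bit ltnNge leq_addr /= addKn.
Qed.

Lemma run_startE k : k <= n -> run_start len k <= total_length.+1.
Proof. by move=> le_kn; exact: leq_run_start. Qed.

Lemma leq_total_length i : i < n -> len i <= total_length.
Proof.
move=> lt_in; have := run_startE lt_in; rewrite run_startS //.
by rewrite /run_start addSn ltnS; apply: leq_trans; rewrite leq_addl.
Qed.

Lemma structure_query (R : realType) k i : w = 8 * k -> n < 2 ^ k ->
  3 * total_length <= 4 * n -> i < n ->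
  exists2 t, t <= 14 * (trunc_log 2 (nb_blocks %/ (len i %/ (4 * w)).+1)).+1
                + (if len i < 4 * w then 12 * (4 * w) + 7 else 0) + 21 &
    query_returns query_program w structure_bits i.+1 t
      ((len i)%:R / total_length%:R : R)%R.
Proof.
move=> def_w lt_n le_N lt_in.
have le_i := ltnW lt_in.
have le_len := leq_total_length lt_in.
have le_S : run_start len i.+1 <= total_length.+1 := run_startE lt_in.
have addE : run_start len i + len i = run_start len i.+1 by rewrite run_startS.
have le_block : 4 * w * nb_blocks <= total_length.+1 + 4 * w.
  by rewrite /nb_blocks mulnS addnC leq_add2r mulnC leq_divM.
have ge_block : total_length.+1 <= 4 * w * nb_blocks.
  by rewrite /nb_blocks mulnC ltnW // ltn_ceil //; lia.
have le_nb : nb_blocks <= total_length.+2 by rewrite ltnS leq_div.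
have lt_k : k < 2 ^ k by exact: ltn_expl.
(* Here [k > 0], so [2 ^ (7 * k)] is at least 128. All addresses are linear in [n] and [k], both
   below [2 ^ k], hence nothing overflows. *)
have small_w : 128 * 2 ^ k <= 2 ^ w.
  rewrite def_w (_ : 8 * k = 7 * k + k); last by lia.
  by rewrite expnD leq_mul2r (@leq_exp2l 2 7) //; apply/orP; right; lia.
have addr_small : bitvector_base + 4 * w * nb_blocks + 2 * nb_blocks + 8 < 2 ^ w.
  by rewrite /bitvector_base; lia.
have rank_gt pos : (i.+1 < run_at n len pos) = (run_start len i + len i <= pos).
  by rewrite ltnNge leq_run_at // -leqNgt addE.
have rank_lt pos : (run_at n len pos < i.+1) = (pos < run_start len i).
  by rewrite ltnS leq_run_at.
apply: (@query_returns_run w structure_bits i.+1 total_length nb_blocks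
          bitvector_base (run_at n len) (run_start len i)) => //.
- by rewrite directory_wordE //= /directory_word /=; lia.
- by rewrite directory_wordE //= /directory_word /=; lia.
- by rewrite directory_wordE //= /directory_word /= ltn_expl.
- by rewrite directory_wordE //= /directory_word /=; lia.
- move=> j lt_j.
  have dirE : directory_word (4 + 2 * j) = run_at n len (4 * w * j).
    rewrite /directory_word /= (_ : (4 + 2 * j - 4) %/ 2 = j); last by lia.
    by rewrite oddD oddM.
  have lt_r : 4 + 2 * j < bitvector_base by rewrite /bitvector_base; lia.
  rewrite directory_wordE // dirE //.
  by apply: leq_ltn_trans (run_at_max _ _ _) _; lia.
- move=> j lt_j rank_j.
  have dirE : directory_word (5 + 2 * j) = len i.
    rewrite /directory_word /= (_ : (5 + 2 * j - 4) %/ 2 = j); last by lia.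
    by rewrite oddD oddM rank_j.
  have lt_r : 5 + 2 * j < bitvector_base by rewrite /bitvector_base; lia.
  by rewrite directory_wordE // dirE; lia.
- by move=> pos; rewrite addE => lt_pos; apply: bitvectorE; lia.
- exact: run_atS.
- by rewrite addE; lia.
- lia.
- have := trunc_log_ltn (nb_blocks %/ (len i %/ (4 * w)).+1) (isT : 1 < 2).
  by rewrite ltn_divLR // mulnC => /ltnW.
Qed.

End DataStructure.

(** * Entropy and logarithms *)

Section Logarithm.
Variable R : realType.
Implicit Types x y : R.

Let ln2_gt0 : 0 < ln 2 :> R. Proof. by rewrite ln_gt0 // ltr1n. Qed.

Lemma log2M x y : 0 < x -> 0 < y -> log2 (x * y) = log2 x + log2 y.
Proof. by move=> x_gt0 y_gt0; rewrite /log2 lnM ?posrE // mulrDl. Qed.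

Lemma ler_log2 x y : 0 < x -> x <= y -> log2 x <= log2 y.
Proof.
move=> x_gt0 le_xy; rewrite /log2 ler_pM2r ?invr_gt0 // ler_ln ?posrE //.
exact: lt_le_trans le_xy.
Qed.

Lemma ltr_log2 x y : 0 < x -> x < y -> log2 x < log2 y.
Proof.
move=> x_gt0 lt_xy; rewrite /log2 ltr_pM2r ?invr_gt0 // ltr_ln ?posrE //.
exact: lt_trans lt_xy.
Qed.

Lemma log2_expn k : log2 (2 ^+ k : R) = k%:R.
Proof.
by rewrite /log2 lnXn // -[ln 2 *+ k]mulr_natl mulfK // gt_eqF.
Qed.

Lemma log2_ge0 x : 1 <= x -> 0 <= log2 x.
Proof. by move=> x_ge1; rewrite -[0]/(0%:R) -(log2_expn 0) ler_log2. Qed.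

End Logarithm.

Section Entropy.
Variables (R : realType) (n : nat) (p q : 'I_n -> R).
Hypothesis p_distr : is_distribution p.

(** Each logarithm is below [k] and the weights sum to 1. The hypothesis also forces [q i > 0], so
    no term is infinite. *)
Lemma relative_entropy_lt (k : nat) : (forall i, p i < 2 ^+ k * q i) ->
  (relative_entropy p q < (k%:R)%:E)%E.
Proof.
case: p_distr => p_ge0 sum_p lt_pq.
have q_gt0 i : 0 < q i.
  by rewrite -(pmulr_rgt0 _ (exprn_gt0 k (ltr0Sn R 1))) (le_lt_trans _ (lt_pq i)).
pose term i := if p i == 0 then 0 else p i * log2 (p i / q i).
have -> : relative_entropy p q = (\sum_(i < n) term i)%:E.
  rewrite /relative_entropy -sumEFin; apply: eq_bigr => i _; rewrite /term.
  by case: eqP => // _; rewrite gt_eqF.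
have term_lt i : p i != 0 -> term i < p i * k%:R.
  move=> p_neq0; have p_gt0 : 0 < p i by rewrite lt_neqAle eq_sym p_neq0 p_ge0.
  rewrite /term (negPf p_neq0) ltr_pM2l // -log2_expn ltr_log2 ?divr_gt0 //.
  by rewrite ltr_pdivrMr.
have term_le i : term i <= p i * k%:R.
  by have [p0|/term_lt/ltW//] := eqVneq (p i) 0; rewrite /term p0 eqxx mul0r.
(* Terms of zero probability give only equality; strictness comes from one index of positive
   probability. *)
have /existsP[i0 p_neq0] : [exists i, p i != 0].
  apply: contraT => /existsPn p0; move: sum_p; rewrite big1 => [/eqP|i _].
    by rewrite eq_sym oner_eq0.
  by apply/eqP; rewrite -[_ == _]negbK.
rewrite lte_fin; apply: (@lt_le_trans _ _ (\sum_(i < n) p i * k%:R)); last first.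
  by rewrite -mulr_suml sum_p mul1r.
rewrite (bigD1 i0) //= [X in _ < X](bigD1 i0) //=.
by apply: ltr_leD; [exact: term_lt p_neq0 | exact: ler_sum].
Qed.

End Entropy.

(** * Growth of the word size *)

Lemma sqr_trunc_log_le (n : nat) : (0 < n)%N ->
  ((trunc_log 2 n).+1 ^ 2 <= 4 * n)%N.
Proof.
move=> n_gt0; have /andP[le_n _] := trunc_log_bounds (isT : 1 < 2)%N n_gt0.
apply: leq_trans (leq_mul (leqnn 4) le_n); move: (trunc_log 2 n) => k.
have [|] := ltnP k 3; first by case: k => [|[|[|]]].
elim: k => // k IH; rewrite ltnS leq_eqVlt => /orP[/eqP<-//|k_gt2].
have le_k := IH k_gt2.
rewrite [(2 ^ k.+1)%N]expnS mulnCA; apply: leq_trans (leq_mul (leqnn 2) le_k).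
by rewrite -!mulnn; nia.
Qed.

(** After squaring, the left side is at most [4 * K ^ 2 * n], which is below [(e * n) ^ 2] once
    [n >= 4 * K ^ 2 / e ^ 2]. *)
Lemma littleo_word_size (R : realType) (a b c : nat) :
  (fun n => (a * word_size c n + b)%:R : R) =o_\oo (fun n => n%:R : R).
Proof.
apply/eqoP => e e_gt0 /=; near=> n.
have n_gt0 : (0 < n)%N by near: n; exact: nbhs_infty_gt.
rewrite !ger0_norm //.
set K := (a * c + b)%N; set m := (trunc_log 2 n).+1.
have le_K : (a * word_size c n + b <= K * m)%N.
  by rewrite /word_size -/m /K mulnDl mulnA leq_add2l leq_pmulr.
apply: (@le_trans _ _ (K * m)%:R); first by rewrite ler_nat.
have en_ge0 : 0 <= e * n%:R by rewrite mulr_ge0 // ltW.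
rewrite -(@ler_pXn2r _ 2) ?nnegrE // -natrX expnMn.
apply: (@le_trans _ _ (K ^ 2 * (4 * n))%:R).
  by rewrite ler_nat leq_mul // sqr_trunc_log_le.
have le_n : (K ^ 2 * 4)%:R / e ^+ 2 <= n%:R.
  by near: n; exact: nbhs_infty_ger.
rewrite mulnA natrM expr2 mulrACA -expr2 mulrA ler_pM2r ?ltr0n //.
by rewrite mulrC -ler_pdivrMr ?exprn_gt0.
Unshelve. all: by end_near. Qed.

(** * Query time in terms of [log (1 / q_i)] *)

Section QueryTime.
Variable R : realType.

(** If [b <= l], then [l < (l %/ b).+1 * b] bounds the product by [N + 1 + b <= 3 * N]. If [l < b],
    the divisor is 1 and the product is at most [l + N + 1]. *)
Lemma block_ratio_le (N l b : nat) : (0 < l)%N -> (l <= N)%N -> (0 < b)%N ->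
  ((N.+1 %/ b).+1 %/ (l %/ b).+1 * l <= 3 * N)%N.
Proof.
move=> l_gt0 le_lN b_gt0.
have le_Nb := leq_divM N.+1 b; have [lt_lb|le_bl] := ltnP l b.
  by rewrite (divn_small lt_lb) divn1 mulSn; nia.
have le_M := leq_divM (N.+1 %/ b).+1 (l %/ b).+1.
have lt_l := ltn_ceil l b_gt0.
set v := (l %/ b)%N in le_M lt_l *; set s := (N.+1 %/ b)%N in le_M le_Nb *.
by set u := (_ %/ _)%N in le_M *; nia.
Qed.

Lemma search_depth_le (N l b : nat) : (0 < l)%N -> (l <= N)%N -> (0 < b)%N ->
  (trunc_log 2 ((N.+1 %/ b).+1 %/ (l %/ b).+1))%:R
    <= 2 + log2 (N%:R / l%:R : R).
Proof.
move=> l_gt0 le_lN b_gt0; have le_ratio := block_ratio_le l_gt0 le_lN b_gt0.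
set r := (_ %/ (l %/ b).+1)%N in le_ratio *.
have l_gt0' : 0 < l%:R :> R by rewrite ltr0n.
have N_gt0 : 0 < N%:R :> R by rewrite ltr0n (leq_trans l_gt0).
have ratio_ge1 : 1 <= N%:R / l%:R :> R by rewrite ler_pdivlMr // mul1r ler_nat.
have [->|r_gt0] := posnP r; first by rewrite trunc_log0 addr_ge0 ?log2_ge0.
have /andP[le_r _] := trunc_log_bounds (isT : 1 < 2)%N r_gt0.
rewrite -[X in X + _](log2_expn R 2) -[X in X <= _]log2_expn.
rewrite -log2M ?exprn_gt0 ?divr_gt0 // ler_log2 ?exprn_gt0 //.
rewrite mulrA ler_pdivlMr // -!natrX -!natrM ler_nat.
by apply: leq_trans (leq_mul le_r (leqnn l)) _; apply: leq_trans le_ratio _; lia.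
Qed.

(** A run shorter than a block has length O(log n), hence O(sqrt n), so [N / l] is at least of order
    sqrt n and its logarithm pays for the scan. *)
Lemma short_run_log_le (n N l : nat) : (0 < n)%N -> (n <= N)%N ->
  (0 < l)%N -> (l < 4 * word_size 8 n)%N ->
  (trunc_log 2 n)%:R <= 12 + 2 * log2 (N%:R / l%:R : R).
Proof.
move=> n_gt0 le_nN l_gt0; rewrite /word_size mulnA => lt_l.
have /andP[le_n _] := trunc_log_bounds (isT : 1 < 2)%N n_gt0.
have N_gt0 : 0 < N%:R :> R by rewrite ltr0n (leq_trans n_gt0).
have l_gt0' : 0 < l%:R :> R by rewrite ltr0n.
(* Applied to [2 ^ T] instead of [n], this keeps the estimate in powers of 2; the constant is
   [32 ^ 2 * 4 = 2 ^ 12]. *)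
have sqr_T := sqr_trunc_log_le (expn_gt0 2 (trunc_log 2 n)).
rewrite trunc_expnK // in sqr_T.
set T := trunc_log 2 n in lt_l le_n sqr_T *.
have le_sqr : (2 ^ T * l ^ 2 <= 2 ^ 12 * N ^ 2)%N.
  have le_l2 : (l ^ 2 <= 2 ^ 12 * 2 ^ T)%N.
    apply: leq_trans (_ : (32 * T.+1) ^ 2 <= _)%N; first by rewrite leq_sqr ltnW.
    by rewrite expnMn; apply: leq_trans (leq_mul (leqnn _) sqr_T) _; rewrite mulnA.
  apply: leq_trans (leq_mul (leqnn _) le_l2) _.
  rewrite mulnCA leq_pmul2l // -expnD addnn -muln2 expnM leq_sqr.
  exact: leq_trans le_n le_nN.
rewrite mulr_natl mulr2n -[X in X + _](log2_expn R 12) -[X in X <= _]log2_expn.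
have y_gt0 : 0 < N%:R / l%:R :> R by rewrite divr_gt0.
have c_gt0 : 0 < 2 ^+ 12 :> R by rewrite exprn_gt0.
rewrite addrA -(log2M c_gt0 y_gt0) -(log2M (mulr_gt0 c_gt0 y_gt0) y_gt0).
apply: ler_log2; first by rewrite exprn_gt0.
rewrite -mulrA -expr2 expr_div_n mulrA ler_pdivlMr ?exprn_gt0 //.
by rewrite -!natrX -!natrM ler_nat.
Qed.

Lemma query_time_le (n N l t : nat) : (0 < n)%N -> (n <= N)%N ->
  (0 < l)%N -> (l <= N)%N ->
  let w := word_size 8 n in
  (t <= 14 * (trunc_log 2 ((N.+1 %/ (4 * w)).+1 %/ (l %/ (4 * w)).+1)).+1
        + (if l < 4 * w then 12 * (4 * w) + 7 else 0) + 21)%N ->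
  t%:R <= 6000 * Num.max 1 (log2 (N%:R / l%:R : R)).
Proof.
move=> n_gt0 le_nN l_gt0 le_lN w.
have w_gt0 : (0 < 4 * w)%N by rewrite /w /word_size; lia.
have := search_depth_le l_gt0 le_lN w_gt0.
move: (trunc_log 2 (_ %/ _)%N) => d.
have := @short_run_log_le n N l n_gt0 le_nN l_gt0; rewrite -/w.
set m := Num.max _ _; set y := log2 _.
have [m_ge1 m_ge_y] : 1 <= m /\ y <= m by rewrite !le_max !lexx orbT.
case: ltnP => [lt_l /(_ isT) le_T|_ _] le_d le_t.
  (* With [d <= 2 + y] and [trunc_log 2 n <= 12 + 2 * y] the total is at most [5062 + 782 * y],
     below [6000 * m]. *)
  have : (t <= 14 * d + 384 * trunc_log 2 n + 426)%N.
    by move: le_t; rewrite /w /word_size; lia.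
  by rewrite -(ler_nat R) 2!natrD 2!natrM; lra.
have : (t <= 14 * d + 35)%N by lia.
by rewrite -(ler_nat R) natrD natrM; lra.
Qed.

End QueryTime.

(** * The distribution Q *)

Section RunLengths.
Variables (R : realType) (n : nat) (p : 'I_n -> R).
Hypothesis p_distr : is_distribution p.

(** The value 1 beyond [n] makes runs nonempty at every natural index, as the lemmas on runs
    assume. *)
Definition run_length (k : nat) : nat :=
  oapp (fun i : 'I_n => (Num.truncn (n%:R * p i / 3)).+1) 1%N (insub k).

Local Notation N := (total_length n run_length).

Lemma run_length_gt0 k : (0 < run_length k)%N.
Proof. by rewrite /run_length; case: insub. Qed.

Lemma run_lengthE (i : 'I_n) :
  run_length i = (Num.truncn (n%:R * p i / 3)).+1.
Proof. by rewrite /run_length valK. Qed.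

Lemma distribution_size_gt0 : (0 < n)%N.
Proof.
case: p_distr => _; case: n p => // p0 /eqP.
by rewrite big_ord0 eq_sym oner_eq0.
Qed.

(** The floors sum to at most [n / 3] and the added ones to [n]. *)
Lemma total_length_le : (3 * N <= 4 * n)%N.
Proof.
have [p_ge0 sum_p] := p_distr; rewrite -(ler_nat R) !natrM natr_sum.
have le_len (i : 'I_n) : (run_length i)%:R <= 1 + n%:R * p i / 3.
  by rewrite run_lengthE -add1n natrD lerD2l truncn_le divr_ge0 // mulr_ge0.
have := ler_sum (index_enum 'I_n) (fun i (_ : xpredT i) => le_len i).
by rewrite big_split /= sumr_const card_ord -mulr_suml -mulr_sumr sum_p; lra.
Qed.

Lemma total_length_ge : (n <= N)%N.
Proof.
rewrite -[X in (X <= _)%N]card_ord -sum1_card.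
by apply: leq_sum => i _; exact: run_length_gt0.
Qed.

Definition run_distribution (i : 'I_n) : R := (run_length i)%:R / N%:R.

Let n_gt0 : 0 < n%:R :> R. Proof. by rewrite ltr0n distribution_size_gt0. Qed.

Let N_gt0 : 0 < N%:R :> R.
Proof. by apply: lt_le_trans n_gt0 _; rewrite ler_nat total_length_ge. Qed.

Lemma run_distribution_gt0 i : 0 < run_distribution i.
Proof. by rewrite divr_gt0 // ltr0n run_length_gt0. Qed.

Lemma run_distributionP : is_distribution run_distribution.
Proof.
split=> [i|]; first exact: ltW (run_distribution_gt0 i).
by rewrite -mulr_suml -natr_sum mulfV // gt_eqF.
Qed.

(* (floor (n p / 3) + 1) / N > (n p / 3) / (4 n / 3) = p / 4 *)
Lemma ltr_run_distribution i : p i < 2 ^+ 2 * run_distribution i.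
Proof.
have le_N := total_length_le.
rewrite -(ler_nat R) !natrM in le_N.
have := truncnS_gt (n%:R * p i / 3); rewrite -run_lengthE => lt_len.
rewrite /run_distribution mulrA ltr_pdivlMr //.
have p_ge0 := p_distr.1 i.
by nra.
Qed.

Lemma invr_run_distribution_le i : (run_distribution i)^-1 <= 2 * n%:R.
Proof.
rewrite invf_div ler_pdivrMr ?ltr0n ?run_length_gt0 //.
have le_N : N%:R <= 2 * n%:R :> R.
  by rewrite -natrM ler_nat; have := total_length_le; lia.
by apply: le_trans le_N _; rewrite ler_peMr ?mulr_ge0 // ler1n run_length_gt0.
Qed.

(** Two bounds, one for each argument of the minimum: [1 / q <= 4 / p], and
    [1 / q <= 2 * n = 2 * (n / eps) * eps]. Additive constants are absorbed using [m >= 1]. *)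
Lemma log2_run_distribution_le (eps : R) i : 0 < eps ->
  log2 (1 / run_distribution i) <=
    (3 + log2 (Num.max 1 eps)) * Num.max 1 (log2 (min_inv (p i) (n%:R / eps))).
Proof.
move=> eps_gt0; have q_gt0 := run_distribution_gt0 i.
rewrite div1r; set q := run_distribution i in q_gt0 *.
have log_eps_ge0 : 0 <= log2 (Num.max 1 eps) by rewrite log2_ge0 // le_max lexx.
set m := Num.max _ (log2 (min_inv _ _)).
have m_ge1 : 1 <= m by rewrite le_max lexx.
have m_gt0 : 0 < m := lt_le_trans ltr01 m_ge1.
have of_p : p i != 0 -> log2 (p i)^-1 <= m ->
    log2 q^-1 <= (3 + log2 (Num.max 1 eps)) * m.
  move=> p_neq0 le_m.
  have p_gt0 : 0 < p i by rewrite lt_neqAle eq_sym p_neq0 (p_distr.1 i).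
  have : log2 q^-1 <= 2 + log2 (p i)^-1.
    rewrite -[X in X + _](log2_expn R 2) -log2M ?invr_gt0 ?exprn_gt0 //.
    rewrite ler_log2 ?invr_gt0 // ler_pdivlMr // mulrC ler_pdivrMr //.
    exact: ltW (ltr_run_distribution i).
  by move=> /le_trans; apply; nra.
have of_n : log2 (n%:R / eps) <= m ->
    log2 q^-1 <= (3 + log2 (Num.max 1 eps)) * m.
  move=> le_m.
  have : log2 q^-1 <= 1 + (log2 (n%:R / eps) + log2 (Num.max 1 eps)).
    apply: (@le_trans _ _ (1 + (log2 (n%:R / eps) + log2 eps))).
      rewrite -log2M ?divr_gt0 // divfK ?gt_eqF //.
      rewrite -[X in X + _](log2_expn R 1) -log2M // ler_log2 ?invr_gt0 //.
      exact: invr_run_distribution_le.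
    (* For [eps < 1] the term [log2 eps] is negative; the maximum with 1 keeps the constant
       nonnegative. *)
    by rewrite !lerD2l ler_log2 // le_max lexx orbT.
  by move=> /le_trans; apply; nra.
have : log2 (min_inv (p i) (n%:R / eps)) <= m by rewrite le_max lexx orbT.
rewrite /min_inv; case: eqVneq => [_|p_neq0]; first exact: of_n.
by rewrite minEle; case: ifP => _; [exact: of_p | exact: of_n].
Qed.

End RunLengths.

Theorem theorem6 (R : realType) :
  exists (prog : program) (c : nat) (extra : nat -> nat) (Ct : R) (Cq : R -> R),
    [/\ (0 < c)%N,
        (fun n => (extra n)%:R : R) =o_\oo (fun n => n%:R : R),
        {homo Cq : x y / x <= y} &
        forall (n : nat) (p : 'I_n -> R) (eps : R),
          is_distribution p -> 0 < eps ->
          exists (D : seq bool) (q : 'I_n -> R),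
            [/\ (size D <= 2 * n + extra n)%N,
                is_distribution q,
                (relative_entropy p q < (2 + eps)%:E)%E &
                forall i : 'I_n,
                  [/\ 0 < q i,
                      (exists t : nat,
                         query_returns prog (word_size c n) D i.+1 t (q i) /\
                         t%:R <= Ct * Num.max 1 (log2 (1 / q i))) &
                      log2 (1 / q i) <=
                        Cq eps * Num.max 1 (log2 (min_inv (p i) (n%:R / eps)))]]].
Proof.
exists query_program, 8%N, (fun n => (6 * word_size 8 n + 3)%N), 6000.
exists (fun e => 3 + log2 (Num.max 1 e)); split=> //.
- exact: littleo_word_size.
- move=> x y le_xy; rewrite lerD2l ler_log2 ?lt_max ?ltr01 //.
  by rewrite ge_max !le_max lexx le_xy orbT.
move=> n p eps p_distr eps_gt0.
have n_gt0 := distribution_size_gt0 p_distr.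
have len_gt0 := run_length_gt0 p.
have le_N := total_length_le p_distr.
have w_gt0 : (0 < word_size 8 n)%N by [].
exists (structure_bits n (word_size 8 n) (run_length p)), (run_distribution p).
split.
- exact: size_structure_bits.
- exact: run_distributionP.
- apply: lt_trans (relative_entropy_lt p_distr (ltr_run_distribution p_distr)) _.
  by rewrite lte_fin ltrDl.
move=> i; split.
- exact: run_distribution_gt0.
(* The word size is [8 * k] with [k = (trunc_log 2 n).+1], for which [n < 2 ^ k]. *)
- have [t le_t returns] := structure_query len_gt0 w_gt0 R (erefl (word_size 8 n))
    (trunc_log_ltn n (isT : 1 < 2)%N) le_N (ltn_ord i).
  exists t; split=> //; rewrite div1r invf_div.
  apply: query_time_le le_t => //; first exact: total_length_ge.
  exact: leq_total_length.
exact: log2_run_distribution_le.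
Qed.
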